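(* Let $\Lambda$ be an admissible set that consists of algebraically independent numbers (in the sense defined in the context) and satisfies $$\limsup_{n\to\infty}\frac{\#(\Lambda\cap[0,n))}{n}=\infty.$$ Then every admissible set $\Lambda'$ satisfying $\Lambda'\subseteq\Lambda$ or $\Lambda\subseteq\Lambda'$ is type 2.
   Context: Convention: a set of (distinct) real numbers $\{\alpha_1,\alpha_2,\dots\}$ is said to consist of algebraically independent numbers if for each $N\in\mathbb{N}$, whenever $k_1,\dots,k_N\in\mathbb{Z}$ and $k_1\alpha_1+\dots+k_N\alpha_N=0$, then $k_1=\dots=k_N=0$ (that is, the numbers are linearly independent over $\mathbb{Q}$). $\#A$ denotes the cardinality of $A$. A set $\Lambda\subset\mathbb{R}$ is called admissible if it is countably infinite, unbounded, bounded from below, and has no finite accumulation points. Let $\mu$ denote Lebesgue measure on $\mathbb{R}$. For an admissible $\Lambda$ and a (Lebesgue) measurable $f:\mathbb{R}\to[0,+\infty)$, put $s(x)=\sum_{\lambda\in\Lambda}f(x+\lambda)$, $C(f,\Lambda)=\{x\in\mathbb{R}: s(x)<\infty\}$ and $D(f,\Lambda)=\{x\in\mathbb{R}: s(x)=\infty\}$. The set $\Lambda$ is type 1 if for every measurable $f:\mathbb{R}\to[0,+\infty)$ either $\mu(D(f,\Lambda))=0$ or $\mu(C(f,\Lambda))=0$. Otherwise $\Lambda$ is type 2. *)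

(* Defs.v *)
From HB Require Import structures.
From mathcomp Require Import all_boot all_order all_algebra.
From mathcomp Require Import all_classical all_reals all_analysis.

Set Implicit Arguments.
Unset Strict Implicit.
Unset Printing Implicit Defensive.

Import Order.TTheory GRing.Theory Num.Theory.
Import numFieldNormedType.Exports.

Local Open Scope classical_set_scope.
Local Open Scope ring_scope.

Definition admissible (R : realType) (L : set R) : Prop :=
  [/\ countable L, infinite_set L, ~ bounded_set L, has_lbound L
    & limit_point L = set0].

(* Despite the name, this is linear independence over the integers: it is how
   the source defines "consisting of algebraically independent numbers". *)
Definition alg_independent (R : realType) (L : set R) : Prop :=
  forall (N : nat) (a : 'I_N -> R) (k : 'I_N -> int),
    injective a -> (forall i, L (a i)) ->
    \sum_(i < N) (k i)%:~R * a i = 0 ->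
    forall i, k i = 0.

(* R with the sigma-algebra of Lebesgue measurable sets, the domain of
   completed_lebesgue_measure; the canonical one on R is the Borel one. *)
Notation lebesgueType R := (caratheodory_type (@wlength R idfun)^*%mu).

Definition lebesgue_measurable_fun (R : realType) (f : R -> R) : Prop :=
  measurable_fun [set: lebesgueType R] (f : lebesgueType R -> R).

Definition trans_sum (R : realType) (f : R -> R) (L : set R) (x : R) : \bar R :=
  (\esum_(l in L) (f (x + l))%:E)%E.

Definition conv_set (R : realType) (f : R -> R) (L : set R) : set R :=
  [set x | (trans_sum f L x < +oo)%E].

Definition div_set (R : realType) (f : R -> R) (L : set R) : set R :=
  [set x | trans_sum f L x = +oo%E].

Definition type1 (R : realType) (L : set R) : Prop :=
  forall f : R -> R, lebesgue_measurable_fun f -> (forall x, 0 <= f x) ->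
    completed_lebesgue_measure (div_set f L) = 0%E \/
    completed_lebesgue_measure (conv_set f L) = 0%E.

Definition type2 (R : realType) (L : set R) : Prop := ~ type1 L.

(* For n = 0 the value is 0 * +oo = 0. *)
Definition counting_ratio (R : realType) (L : set R) (n : nat) : \bar R :=
  (counting (L `&` `[0%R, n%:R[) / n%:R%:E)%E.

(* Main.v *)
Require Import Defs.
From mathcomp Require Import all_boot all_order all_algebra.
From mathcomp Require Import all_classical all_reals all_analysis.
From mathcomp Require Import ring lra zify.

(** Whether a set is of type 2 is decided here by indicators of open sets [E]:
    if some set of positive measure consists of points [x] with infinitely many
    translates [x + l] in [E], and another one of points with none, then the
    indicator of [E] separates convergence from divergence
    ([type2_of_open]). Write [M] for the set to be shown of type 2.

    Suppose first that [M] has infinitely many gaps of length at least [d > 0],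
    say to the right of its points [g]. The intervals [(g + d/2, g + d)] form
    such an [E]: points of [(d/2, d)] hit it through every [g], and points of
    [(0, d/2)] never do, because they could hit it only through an element of
    [M] inside a gap ([type2_of_gaps]).

    Otherwise [M] is a superset of an independent set [L] whose counting
    function outgrows every linear function: for a superset of the given set
    this is the hypothesis on the upper limit, and for a subset without large
    gaps one takes [L = M], the gaps shrinking to [0]
    ([superlinear_of_no_gaps]). The rational dimension of the span of
    [M] below [n] is at least the number of elements of [L] in [[0, n)], so it
    outgrows every linear function too; hence for every [K] there are
    arbitrarily large [n] for which [M] has [K] points in [[n, n + 1)] that are
    linearly independent modulo the span of [M] below [n]
    ([independent_block]). This is where a superlinear count is needed: the
    other elements of [M] are arbitrary.

    By Kronecker's approximation theorem ([kronecker], [kronecker_mod]) some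
    frequency [t] makes [t * l] nearly an integer for all the elements [l < n]
    of [M], while [t * l] modulo [1] is spread evenly over the circle when [l]
    runs over the independent points. Let [E] be the set of those [y] in
    [(n, n + 2)] for which [t * y] modulo [1] lies in an arc of length of order
    [1 / K]. Each [x] in [(0, 1)] has a translate in [E], as the rotated arcs
    cover the circle. For [x] in [(2, 3)] only elements [l < n] matter, and
    these do not move the arc: [x] has a translate in [E] only if [t * x]
    modulo [1] lies in a slightly longer arc, which for a suitable choice of
    the arc happens on measure at most [1 / K] ([separating_stage]). Uniting
    these sets [E] for infinitely many [n], with a summable sequence of values
    of [1 / K], gives divergence on [(0, 1)] and convergence on a subset of
    [(2, 3)] of positive measure ([type2_of_superlinear]).

    Kronecker's theorem is proved by linear algebra. The integer vectors close
    to some multiple [t * v] span a rational subspace; Dirichlet's theorem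
    supplies such vectors with [t] arbitrarily large, so any rational form that
    vanishes on the subspace vanishes at [v], hence at the target by
    hypothesis. The target is therefore a real combination of integer vectors
    close to multiples of [v], and replacing the coefficients by their
    fractional parts changes it by an integer vector only, while keeping the
    total error under control. *)

Set Implicit Arguments.
Unset Strict Implicit.
Unset Printing Implicit Defensive.

Import Order.TTheory GRing.Theory Num.Theory.
Import numFieldNormedType.Exports.

Local Open Scope classical_set_scope.
Local Open Scope ring_scope.

(** * Kronecker's approximation theorem *)

(** A finite family of vectors of [P] of maximal rank spans [P]; a maximal
    independent subfamily is then a basis. *)
Lemma row_basis_of_set (F : fieldType) (n : nat) (P : set 'rV[F]_n) :
  exists r (A : 'M[F]_(r, n)),
    [/\ (r <= n)%N, forall i, P (row i A) & forall p, P p -> (p <= A)%MS].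
Proof.
pose Q k := `[< exists r (A : 'M[F]_(r, n)),
  (forall i, P (row i A)) /\ \rank A = k >].
have Q0 : exists k, Q k.
  by exists 0%N; apply/asboolP; exists 0%N, 0; split=> [[]//|]; rewrite mxrank0.
have Qle k : Q k -> (k <= n)%N.
  by case/asboolP => r [A [_ <-]]; exact: rank_leq_col.
case: (ex_maxnP Q0 Qle) => k /asboolP[r [A [PA rA]]] kmax.
exists (\rank A), (rowsub (maxrankfun A) A); split=> [|i|p Pp].
- exact: rank_leq_col.
- by rewrite row_rowsub; exact: PA.
rewrite eq_maxrowsub.
have /kmax : Q (\rank (col_mx A p)).
  apply/asboolP; exists (r + 1)%N, (col_mx A p); split=> // i.
  case: (fintype.splitP i) => j ij.
    have -> : i = lshift 1 j by exact/val_inj.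
    by rewrite rowKu.
  have -> : i = rshift r j by exact/val_inj.
  by rewrite rowKd row_id.
rewrite -rA => rle.
have AC : (A <= col_mx A p)%MS by rewrite -addsmxE addsmxSl.
have : (col_mx A p <= A)%MS by rewrite -(geq_leqif (mxrank_leqif_sup AC)).
by rewrite -addsmxE => /(submx_trans (addsmxSr _ _)).
Qed.

Section Kronecker.
Variable R : realType.
Implicit Types (e t : R).

(** The usual pigeonhole argument, applied to the multiples of [T] instead of
    the integers so that [t] can be made as large as desired. *)
Lemma dirichlet (n : nat) (v : 'I_n -> R) e T : 0 < e -> 0 < T ->
  exists t, T <= t /\ exists p : 'I_n -> int,
    forall j, `|t * v j - (p j)%:~R| < e.
Proof.
move=> e0 T0.
pose N := (Num.truncn e^-1).+1.
have Ne : N%:R^-1 < e.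
  rewrite -[ltRHS]invrK ltf_pV2 ?posrE ?invr_gt0 ?ltr0n//.
  by rewrite /N truncnS_gt.
have N0 : 0 < N%:R :> R by rewrite ltr0n.
pose fr (x : R) := x - (Num.floor x)%:~R.
have fr01 x : 0 <= fr x < 1.
  have := Num.Theory.floor_itv x; rewrite intrD /fr => /andP[h1 h2].
  by apply/andP; split; lra.
have cellP (x : R) : (Num.truncn (N%:R * fr x)%R < N)%N.
  have /andP[h0 h1] := fr01 x.
  by rewrite truncn_lt_nat ?mulr_ge0 ?ler0n// gtr_pMr.
(* The unit cube is cut into N ^ n cells of side 1 / N; cell q is the one that
   contains the fractional part of q * T * v. *)
pose cell (q : 'I_(N ^ n).+1) : {ffun 'I_n -> 'I_N} :=
  [ffun j => Ordinal (cellP (q%:R * T * v j))].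
have : ~ injective cell.
  move=> /leq_card; rewrite card_ffun !card_ord => h.
  by have := leq_trans (ltnSn _) h; rewrite ltnn.
move=> /existsNP[q1 /existsNP[q2 /not_implyP[cq q12]]].
wlog lt12 : q1 q2 cq q12 / (q1 < q2)%N => [hw|].
  have [h|h|h] := ltngtP q1 q2; first exact: (hw q1 q2).
  - by apply: (hw q2 q1) => // ?; apply: q12.
  - by case: q12; exact/val_inj.
exists ((q2 - q1)%N%:R * T); split.
  by rewrite ler_pMl// ler1n subn_gt0.
exists (fun j =>
  Num.floor (q2%:R * T * v j) - Num.floor (q1%:R * T * v j)) => j.
have := congr1 (fun f : {ffun _ -> _} => val (f j)) cq.
rewrite !ffunE /= => cE.
have tr (x : R) : (Num.truncn (N%:R * fr x)%R)%:R <= N%:R * fr x <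
   (Num.truncn (N%:R * fr x)%R)%:R + 1.
  have /andP[h0 h1] := fr01 x.
  by rewrite natr1; apply: truncn_itv; rewrite mulr_ge0.
have /andP[a1 a2] := tr (q1%:R * T * v j).
have /andP[b1 b2] := tr (q2%:R * T * v j).
rewrite cE in a1 a2.
apply: lt_trans Ne; rewrite -[ltRHS]mul1r ltr_pdivlMr//.
rewrite -[X in _ * X < _]gtr0_norm// -normrM.
have -> : ((q2 - q1)%N%:R * T * v j -
   (Num.floor (q2%:R * T * v j) - Num.floor (q1%:R * T * v j))%:~R) * N%:R =
   N%:R * fr (q2%:R * T * v j) - N%:R * fr (q1%:R * T * v j).
  by rewrite /fr natrB ?(ltnW lt12)// intrB; ring.
by rewrite ltr_norml; apply/andP; split; lra.
Qed.

(** Let the rows of [A] span the integer vectors close to multiples of [v]. The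
    hypothesis puts [theta] in the real row space of [A], say
    [theta = \sum_i c_i A_i] with [A_i] close to [t_i * v]. Dropping the
    integer parts of the [c_i] changes this sum by an integer vector, and
    bounds the error made when [A_i] is replaced by [t_i * v]. *)
Lemma kronecker (n : nat) (v theta : 'rV[R]_n) e : 0 < e ->
  (forall k : 'I_n -> rat, \sum_j ratr (k j) * v 0 j = 0 ->
     \sum_j ratr (k j) * theta 0 j = 0) ->
  exists t, forall j, exists p : int, `|t * v 0 j - theta 0 j - p%:~R| < e.
Proof.
move=> e0 rel.
have n1 : 0 < (n.+1)%:R :> R by rewrite ltr0n.
pose d := e / n.+1%:R.
have d0 : 0 < d by rewrite divr_gt0.
pose close t (p : 'rV[rat]_n) :=
  forall j, `|t * v 0 j - ratr (p 0 j)| < d /\ p 0 j \is a Num.int.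
(* Each row contributes an error less than d, and r <= n whatever d is. *)
have [r [A [rn PA spanA]]] := row_basis_of_set [set p | exists t, close t p].
have [t tP] := choice PA.
have : (theta <= map_mx ratr A)%MS.
  (* A column of the cokernel is a rational form q vanishing on the rows of A;
     if q did not vanish at v, a vector close to u * v with u large would
     contradict q = 0 on the row space. *)
  rewrite submxE -map_cokermx; apply/eqP/matrixP => i c; rewrite !mxE ord1.
  under eq_bigr do rewrite mxE mulrC.
  apply: rel; set q := cokermx A.
  apply/eqP; rewrite -normr_le0 leNgt; apply/negP => s0.
  set s := \sum_j _ in s0.
  pose B := d * \sum_j `|ratr (q j c) : R|.
  have B0 : 0 <= B by rewrite mulr_ge0 ?(ltW d0)// sumr_ge0.
  have T0 : 0 < (B + 1) / `|s| by rewrite divr_gt0// ltr_pwDr.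
  have [u [uT [p pP]]] := dirichlet (fun j => v 0 j) d0 T0.
  have /spanA : exists t, close t (\row_j (p j)%:~R).
    by exists u => j; rewrite mxE ratr_int; split; [exact: pP|exact: intr_int].
  rewrite submxE => /eqP /matrixP /(_ 0 c); rewrite !mxE => pq0.
  have pq : \sum_j ratr (q j c) * (p j)%:~R = 0 :> R.
    have := congr1 (ratr : rat -> R) pq0; rewrite rmorph0 rmorph_sum => pq1.
    rewrite -[RHS]pq1.
    apply: eq_bigr => j _.
    by rewrite rmorphM/= [(\row__ _) _ _]mxE ratr_int mulrC.
  have : `|u * s| <= B.
    have -> : u * s = \sum_j ratr (q j c) * (u * v 0 j - (p j)%:~R).
      rewrite -[LHS]subr0 -[X in _ - X]pq /s mulr_sumr -sumrB.
      by apply: eq_bigr => j _; ring.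
    rewrite /B mulr_sumr (le_trans (ler_norm_sum _ _ _))//.
    by apply: ler_sum => j _; rewrite normrM mulrC ler_pM// ltW.
  rewrite normrM ger0_norm; last first.
    by rewrite (le_trans _ uT)// divr_ge0// addr_ge0.
  by move: uT; rewrite ler_pdivrMr// => h1 h2; lra.
case/submxP => c thetaE.
exists (\sum_i (c 0 i - (Num.floor (c 0 i))%:~R) * t i) => j.
exists (- \sum_i Num.floor (c 0 i) * Num.floor (A i j)).
have Aint i : ratr (A i j) = (Num.floor (A i j))%:~R :> R.
  have [_] := tP i j; rewrite mxE => /floorK {1}<-.
  by rewrite ratr_int.
rewrite [X in `|X|](_ : _ = \sum_i (c 0 i - (Num.floor (c 0 i))%:~R) *
    (t i * v 0 j - ratr (A i j))); last first.
  rewrite thetaE mxE mulr_suml -sumrB rmorphN /= rmorph_sum opprK -big_split/=.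
  apply: eq_bigr => i _; rewrite mxE Aint intrM; ring.
apply: le_lt_trans (_ : \sum_(i < r) d < e).
  apply: (le_trans (ler_norm_sum _ _ _)); apply: ler_sum => i _.
  have [+ _] := tP i j; rewrite mxE => tij.
  have := Num.Theory.floor_itv (c 0 i); rewrite intrD => /andP[h1 h2].
  rewrite normrM -[leRHS]mul1r ler_pM// ?(ltW tij)//.
  by rewrite ger0_norm; lra.
rewrite sumr_const card_ord -mulr_natl /d mulrCA -[ltRHS]mulr1 ltr_pM2l//.
by rewrite ltr_pdivrMr// mul1r ltr_nat ltnS.
Qed.
End Kronecker.

(** * Rational spans of sets of reals *)

Section RationalSpan.
Variable R : realType.
Implicit Types (A B V : set R) (g s : seq R).

Definition is_qspace V := [/\ V 0, forall x y, V x -> V y -> V (x + y)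
  & forall (q : rat) x, V x -> V (ratr q * x)].

Definition qspan A : set R := smallest is_qspace A.

Lemma qspan_qspace A : is_qspace (qspan A).
Proof.
split=> [V [[]]//|x y Vx Vy V [VV AV]|q x Vx V [VV AV]]; have [_ VD VZ] := VV.
  by apply: VD; [exact: Vx|exact: Vy].
by apply: VZ; exact: Vx.
Qed.

Lemma sub_qspan A : A `<=` qspan A.
Proof. by move=> x Ax V [_]; exact. Qed.

Lemma qspan_sub A B : A `<=` qspan B -> qspan A `<=` qspan B.
Proof. by move=> AB; apply: smallest_sub => //; exact: qspan_qspace. Qed.

Lemma qspanS A B : A `<=` B -> qspan A `<=` qspan B.
Proof. by move=> AB; apply: qspan_sub => x /AB; exact: sub_qspan. Qed.

Lemma qspan_sum A (I : Type) (r : seq I) (P : pred I) (c : I -> rat)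
    (x : I -> R) :
  (forall i, P i -> qspan A (x i)) ->
  qspan A (\sum_(i <- r | P i) ratr (c i) * x i).
Proof.
move=> Ax; have [V0 VD VZ] := qspan_qspace A.
by elim/big_ind : _ => // i Pi; apply: VZ; exact: Ax.
Qed.

Lemma qspan_seqP g x : qspan [set` g] x ->
  exists c : 'I_(size g) -> rat, x = \sum_j ratr (c j) * g`_j.
Proof.
pose V := [set x | exists c : 'I_(size g) -> rat, x = \sum_j ratr (c j) * g`_j].
move=> gx; apply: (gx V); split=> [|y /= yg]; last first.
  have yi : (index y g < size g)%N by rewrite index_mem.
  exists (fun j => (j == Ordinal yi)%:R); rewrite (bigD1 (Ordinal yi))//= eqxx.
  rewrite rmorph1 mul1r nth_index// big1 ?addr0// => j /negbTE ->.
  by rewrite rmorph0 mul0r.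
split=> [|_ _ [c ->] [d ->]|q _ [c ->]].
- by exists (fun=> 0); rewrite big1// => j _; rewrite rmorph0 mul0r.
- exists (fun j => c j + d j); rewrite -big_split; apply: eq_bigr => j _ /=.
  by rewrite rmorphD/= mulrDl.
- exists (fun j => q * c j); rewrite mulr_sumr; apply: eq_bigr => j _ /=.
  by rewrite rmorphM/= mulrA.
Qed.

Definition indep_mod A s := forall c : nat -> rat,
  qspan A (\sum_(j < size s) ratr (c j) * s`_j) ->
  forall j, (j < size s)%N -> c j = 0.

Lemma indep_mod_cons A a s : indep_mod A s -> ~ qspan (A `|` [set` s]) a ->
  indep_mod A (a :: s).
Proof.
move=> sA aA c; rewrite big_ord_recl/= => cA.
have [_ VD VZ] := qspan_qspace (A `|` [set` s]).
have sumA : qspan (A `|` [set` s]) (\sum_(j < size s) ratr (c j.+1) * s`_j).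
  by apply: qspan_sum => j _; apply: sub_qspan; right; apply: mem_nth.
have [c0|c0] := eqVneq (c 0%N) 0.
  have := sA (fun j => c j.+1); rewrite c0 rmorph0 mul0r add0r in cA.
  by move=> /(_ cA) sc [|j]//= /sc.
exfalso; apply: aA.
have -> : a = ratr (c 0%N)^-1 * (ratr (c 0%N) * a +
    \sum_(j < size s) ratr (c j.+1) * s`_j +
    ratr (-1) * \sum_(j < size s) ratr (c j.+1) * s`_j).
  rewrite rmorphN1 mulN1r addrK mulrA -rmorphM/= mulVf// rmorph1 mul1r//.
apply: (VZ); apply: (VD); last exact: VZ.
apply: qspanS cA; exact: subsetUl.
Qed.

(** Exchange: independent elements are added one at a time until there are [K]
    of them or nothing of [B] is left to add. *)
Lemma indep_mod_or_span A B K :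
  (exists s, [/\ size s = K, [set` s] `<=` B & indep_mod A s]) \/
  (exists s, [/\ (size s <= K)%N, [set` s] `<=` B &
    B `<=` qspan (A `|` [set` s])]).
Proof.
elim: K => [|K [[s [sK sB sA]]|[s [sK sB Bs]]]].
- by left; exists [::]; split.
- have [Bs|/existsNP[a /not_implyP[Ba nas]]] :=
      EM (B `<=` qspan (A `|` [set` s])).
    by right; exists s; split=> //; rewrite sK.
  left; exists (a :: s); split=> //=; first by rewrite sK.
    by move=> x /=; rewrite inE => /predU1P[->//|/sB].
  exact: indep_mod_cons.
- by right; exists s; split=> //; exact: leqW.
Qed.

(** The target that is zero on [g] and arbitrary on [s] satisfies all the
    rational relations of the list [g ++ s], because these relations do not
    involve [s]. *)
Lemma kronecker_mod g s (theta : nat -> R) e : indep_mod [set` g] s -> 0 < e ->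
  exists t, (forall x, x \in g -> exists p : int, `|t * x - p%:~R| < e) /\
    (forall j, (j < size s)%N ->
       exists p : int, `|t * s`_j - theta j - p%:~R| < e).
Proof.
move=> sg e0.
pose v := row_mx (\row_(i < size g) g`_i) (\row_(j < size s) s`_j).
pose th : 'rV[R]_(size g + size s) := row_mx 0 (\row_(j < size s) theta j).
have [k|t tP] := @kronecker _ _ v th e e0.
  have -> : \sum_j ratr (k j) * v 0 j =
      \sum_(i < size g) ratr (k (lshift _ i)) * g`_i +
      \sum_(j < size s) ratr (k (rshift _ j)) * s`_j.
    rewrite big_split_ord/=; congr (_ + _); apply: eq_bigr => j _.
      by rewrite /v row_mxEl mxE.
    by rewrite /v row_mxEr mxE.
  move=> rel.
  pose c j := if insub j is Some i then k (rshift (size g) i) else 0.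
  have cE (j : 'I_(size s)) : c j = k (rshift _ j) by rewrite /c valK.
  have c0 : forall j, (j < size s)%N -> c j = 0.
    apply: sg; have [_ _ VZ] := qspan_qspace [set` g].
    have -> : \sum_(j < size s) ratr (c j) * s`_j =
        ratr (-1) * \sum_(i < size g) ratr (k (lshift _ i)) * g`_i.
      under eq_bigr do rewrite cE.
      by rewrite rmorphN1 mulN1r; apply/eqP; rewrite -addr_eq0 addrC rel.
    by apply: VZ; apply: qspan_sum => i _; apply: sub_qspan; exact: mem_nth.
  rewrite big_split_ord/= !big1 ?addr0// => j _.
    by rewrite /th row_mxEr -cE c0// rmorph0 mul0r.
  by rewrite /th row_mxEl mxE mulr0.
exists t; split=> [x xg|j js].
  have xi : (index x g < size g)%N by rewrite index_mem.
  have := tP (lshift _ (Ordinal xi)).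
  by rewrite /v /th !row_mxEl !mxE subr0/= nth_index.
by have := tP (rshift _ (Ordinal js)); rewrite /v /th !row_mxEr !mxE.
Qed.

End RationalSpan.

Lemma common_denominator (n : nat) (c : 'I_n -> rat) :
  exists2 d : int, d != 0 & forall i, c i * d%:~R \is a Num.int.
Proof.
exists (\prod_i denq (c i)); first by apply/prodf_neq0 => i _; exact: denq_neq0.
move=> i; rewrite (bigD1 i)//= intrM mulrA -numqE -intrM; exact: intr_int.
Qed.

(** Expanding [s] over [g] gives a rational matrix with more rows than columns
    if [g] is shorter than [s]; a vector of its left kernel, once denominators
    are cleared, is an integer relation between the elements of [s]. *)
Lemma alg_independent_size (R : realType) (L : set R) (g s : seq R) :
  alg_independent L -> uniq s -> [set` s] `<=` L ->
  [set` s] `<=` qspan [set` g] -> (size s <= size g)%N.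
Proof.
move=> Lind us sL sg; rewrite leqNgt; apply/negP => gs.
have /choice[M ME] (i : 'I_(size s)) : exists c : 'rV[rat]_(size g),
    s`_i = \sum_j ratr (c 0 j) * g`_j.
  have [c cE] := qspan_seqP (sg _ (mem_nth 0 (ltn_ord i))).
  by exists (\row_j c j); rewrite cE; apply: eq_bigr => j _; rewrite mxE.
pose A := \matrix_i M i.
have : kermx A != 0.
  rewrite kermx_eq0 -row_leq_rank -ltnNge.
  exact: leq_ltn_trans (rank_leq_col _) gs.
case/rowV0Pn => w /sub_kermxP wA w0.
have [d d0 dint] := common_denominator (w 0).
pose k i := Num.floor (w 0 i * d%:~R).
have kE i : ratr (w 0 i) * d%:~R = (k i)%:~R :> R.
  by rewrite -(ratr_int R (k i)) floorK// rmorphM/= ratr_int.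
have : forall i, k i = 0.
  apply: (Lind _ (fun i : 'I_(size s) => s`_i)) => [i j /eqP|i|].
  - by rewrite nth_uniq// => /eqP/val_inj.
  - by apply: sL; exact: mem_nth.
  transitivity (d%:~R * \sum_i \sum_j ratr (w 0 i * A i j) * g`_j).
    rewrite mulr_sumr; apply: eq_bigr => i _; rewrite -kE ME.
    rewrite [RHS]mulrC mulrAC mulr_sumr; congr (_ * _).
    by apply: eq_bigr => j _; rewrite mxE rmorphM/= mulrA.
  rewrite exchange_big/= big1 ?mulr0// => j _; rewrite -mulr_suml -rmorph_sum.
  have := congr1 (fun X : 'rV_(size g) => X 0 j) wA; rewrite !mxE => ->.
  by rewrite rmorph0 mul0r.
move=> k0; case/eqP: w0; apply/rowP => i; rewrite mxE.
have : ratr (w 0 i) * d%:~R = 0 :> R by rewrite kE k0.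
by move/eqP; rewrite mulf_eq0 intr_eq0 (negbTE d0) orbF fmorph_eq0 => /eqP.
Qed.

(** * Blocks of new independent elements *)

Definition superlinear (R : realType) (L : set R) := forall d K : nat,
  exists n s,
    [/\ uniq s, [set` s] `<=` L `&` `[0, n%:R[ & (d + K * n < size s)%N].

(** If from [n0] on every unit interval contributed at most [K] dimensions to
    the span of [L'], this span would have dimension at most linear in [n]
    below [n], which leaves no room for the independent elements of [L]. *)
Lemma independent_block (R : realType) (L L' : set R) :
  (forall y, finite_set (L' `&` [set x | x < y])) ->
  alg_independent L -> superlinear L -> L `<=` L' ->
  forall n0 K, exists n s, [/\ (n0 <= n)%N, size s = K,
    [set` s] `<=` L' `&` `[n%:R, n.+1%:R[ &
    indep_mod (L' `&` [set x | x < n%:R]) s].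
Proof.
move=> finL' Lind Lsup LL' n0 K; apply: contrapT => none.
have [s0 s0E] := (finite_seqP _).1 (finL' n0%:R).
have cover m : exists2 g, (size g <= size s0 + K * m)%N &
    L' `&` [set x | x < (n0 + m)%:R] `<=` qspan [set` g].
  elim: m => [|m [g gm gL]].
    exists s0; first by rewrite muln0 addn0.
    by rewrite addn0 s0E; exact: sub_qspan.
  have [[s [sK sL sind]]|[s [sK sL Ls]]] := indep_mod_or_span
      (L' `&` [set x | x < (n0 + m)%:R])
      (L' `&` `[(n0 + m)%:R, (n0 + m).+1%:R[) K.
    by exfalso; apply: none; exists (n0 + m)%N, s; split=> //; exact: leq_addr.
  exists (g ++ s).
    by rewrite size_cat mulnS [(K + _)%N]addnC addnA leq_add.
  have gs : [set` g] `|` [set` s] `<=` [set` g ++ s].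
    by move=> x [|]/=; rewrite mem_cat => ->//; rewrite orbT.
  move=> x [L'x /=]; rewrite addnS => xm.
  have [xlt|xge] := ltP x (n0 + m)%:R.
    by apply: qspanS (gL x _) => //; apply: subset_trans gs; exact: subsetUl.
  have : qspan (L' `&` [set x | x < (n0 + m)%:R] `|` [set` s]) x.
    by apply: Ls; split=> //=; rewrite in_itv/= xge.
  apply: qspan_sub => y [/gL|ys].
    by apply: qspanS; apply: subset_trans gs; exact: subsetUl.
  by apply: sub_qspan; apply: gs; right.
have [n [s [us sL sbig]]] := Lsup (size s0) K.
have [g gs gL] := cover n.
suff : (size s <= size g)%N by move=> /leq_trans/(_ gs); rewrite leqNgt sbig.
apply: (alg_independent_size Lind us) => [x /sL[]//|x /sL[Lx]].
rewrite /= in_itv/= => /andP[_ xn]; apply: gL; split=> /=; first exact: LL'.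
by rewrite (lt_le_trans xn)// ler_nat leq_addl.
Qed.

(** * A criterion for type 2, and sets with large gaps *)

(** Both measures are given by the Lebesgue outer measure, which is monotone on
    all sets. *)
Lemma completed_lebesgue_measure_gt0 (R : realType) (A X : set R) :
  (0 < @lebesgue_measure R A)%E -> A `<=` X ->
  completed_lebesgue_measure X <> 0%E.
Proof.
move=> A0 AX X0; move: A0; apply/negP; rewrite -leNgt -X0.
exact: (le_outer_measure (@wlength R idfun)^*%mu).
Qed.

Lemma type2_of_open (R : realType) (L E D C : set R) : open E ->
  (0 < @lebesgue_measure R D)%E -> (0 < @lebesgue_measure R C)%E ->
  (forall x, D x -> infinite_set (L `&` [set l | E (x + l)])) ->
  (forall x l, C x -> L l -> ~ E (x + l)) -> type2 L.
Proof.
move=> oE D0 C0 DE CE /(_ \1_E)[|//||].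
- move=> _ Y mY; rewrite setTI; apply: sub_caratheodory.
  rewrite -[X in _ X]setTI.
  apply: measurable_realfun.measurable_indic => //.
  exact: measurable_realfun.open_measurable.
- apply: (completed_lebesgue_measure_gt0 D0) => x Dx; rewrite /div_set/=.
  apply/eqP; rewrite -leye_eq -(infinite_card_dirac R (DE _ Dx)).
  rewrite /trans_sum esum_mkcondr; apply: le_esum => l Ll.
  case: ifPn => [|_]; last by rewrite lee_fin.
  rewrite inE /= => El; rewrite diracE indicE lee_fin.
  by rewrite [_ + _ \in E]mem_set// ler_nat leq_b1.
- apply: (completed_lebesgue_measure_gt0 C0) => x Cx; rewrite /conv_set/=.
  rewrite /trans_sum esum1// => l Ll.
  by rewrite indicE memNset//; exact: CE.
Qed.

Section Admissible.
Variables (R : realType) (L : set R).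
Hypothesis admL : admissible L.

Lemma admissible_finite (y : R) : finite_set (L `&` [set x | x < y]).
Proof.
case: admL => _ _ _ [a La] lim0; apply: contrapT => inf.
have [|z zL] := infinite_bounded_limit_point_nonempty inf.
  exists (`|a| + `|y|); split; first exact: num_real.
  move=> M yM x [/La /= ax xy]; have := ler_norm y; have := ler_norm (- a).
  have := normr_ge0 y; have := normr_ge0 a; rewrite normrN => *.
  by rewrite ler_norml; apply/andP; split; lra.
suff : limit_point L z by rewrite lim0.
by move=> U /zL[p [pz [Lp _] Up]]; exists p.
Qed.

Lemma admissible_unbounded (y : R) : exists2 l, L l & y <= l.
Proof.
case: (admL) => _ infL _ _ _; apply: contrapT => noL; apply: infL.
apply: sub_finite_set (admissible_finite y) => l Ll; split=> //=.
by rewrite ltNge; apply/negP => yl; apply: noL; exists l.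
Qed.

Definition gap_start (d : R) : set R :=
  [set g | L g /\ forall l, L l -> g < l -> g + d <= l].

Lemma type2_of_gaps d : 0 < d -> infinite_set (gap_start d) -> type2 L.
Proof.
move=> d0 infG.
apply: (@type2_of_open R L
    (\bigcup_(g in gap_start d) `]g + d / 2, g + d[%classic)
    `]d / 2, d[%classic `]0, d / 2[%classic).
- by apply: bigcup_open => g _; exact: interval_open.
- rewrite lebesgue_measure_itv/= lte_fin ifT -?EFinB ?lte_fin; lra.
- rewrite lebesgue_measure_itv/= lte_fin ifT -?EFinB ?lte_fin; lra.
- move=> x; rewrite /= in_itv/= => /andP[x1 x2].
  apply: sub_infinite_set infG => g [Lg Gg]; split=> //=.
  by exists g => //=; rewrite in_itv/=; apply/andP; split; lra.
- move=> x l; rewrite /= in_itv/= => /andP[x1 x2] Ll [g [Lg Gg]].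
  rewrite /= in_itv/= => /andP[h1 h2].
  suff : g + d <= l by lra.
  apply: Gg => //; lra.
Qed.

(** Beyond some point each element has a successor at distance less than
    [1 / (K + 1)], so that intervals of length [m] contain about [(K + 1) * m]
    elements. *)
Lemma superlinear_of_no_gaps :
  (forall d, 0 < d -> finite_set (gap_start d)) -> superlinear L.
Proof.
move=> finG d K; pose e : R := K.+1%:R^-1.
have e0 : 0 < e by rewrite invr_gt0.
have [G GE] := (finite_seqP _).1 (finG _ e0).
pose M := \sum_(g <- G) `|g| + 1.
have GM g : gap_start e g -> g < M.
  rewrite GE /= /M => gG; rewrite (big_rem g)//=.
  have : 0 <= \sum_(y <- rem g G) `|y| by exact: sumr_ge0.
  by have := ler_norm g; lra.
have M0 : 0 <= M by rewrite addr_ge0// sumr_ge0.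
have [a0 La0 Ma0] := admissible_unbounded M.
have /choice[nxt nxtP] (a : R) : exists b, L a -> M <= a ->
    [/\ L b, a < b & b < a + e].
  have [[La Ma]|na] := EM (L a /\ M <= a); last by exists 0 => *; case: na.
  have : ~ gap_start e a by move=> /GM; rewrite ltNge Ma.
  move=> /not_andP[//|/existsNP[b /not_implyP[Lb /not_implyP[ab /negP]]]].
  by rewrite -ltNge => bae; exists b.
pose a i := iter i nxt a0.
have aP i : L (a i) /\ M <= a i.
  elim: i => // i [Lai Mai]; have [? ? _] := nxtP _ Lai Mai.
  by split=> //; rewrite (le_trans Mai)// ltW.
have astep i : a i < a i.+1 /\ a i.+1 < a i + e.
  by have [? ?] := aP i; have [] := nxtP (a i).
have ale i : a i <= a0 + i%:R * e.
  elim: i => [|i IH]; first by rewrite mul0r addr0.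
  by have [_ ?] := astep i; rewrite -natr1; lra.
have ainj : injective a.
  have alt : {homo a : i j / (i < j)%N >-> i < j}.
    by apply: homo_ltn => [? ? ?|i]; [exact: lt_trans|case: (astep i)].
  move=> i j aij; have [|+|//] := ltngtP i j => /alt; by rewrite aij ltxx.
pose b := (Num.truncn a0).+1.
have a0b : a0 < b%:R by rewrite truncnS_gt.
(* m is large enough for (K + 1) * m > d + K * (b + m). *)
pose m := (d + K * b).+1.
exists (b + m)%N, [seq a i | i <- iota 0 (K.+1 * m)]; split.
- by rewrite map_inj_uniq ?iota_uniq.
- move=> _ /mapP[i + ->]; rewrite mem_iota add0n => /andP[_ im]; split.
    exact: (aP i).1.
  rewrite /= in_itv/= (le_trans M0 (aP i).2)/=.
  apply: le_lt_trans (ale i) _; rewrite natrD ltr_leD//.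
  rewrite /e ler_pdivrMr// mulrC -natrM ler_nat; exact: ltnW.
- by rewrite size_map size_iota /m; lia.
Qed.

Lemma superlinear_of_limsup :
  limn_esup (counting_ratio L) = +oo%E -> superlinear L.
Proof.
move=> sup d K; apply: contrapT => none.
have : (limn_esup (counting_ratio L) <= (d + K)%:R%:E)%E.
  apply: le_trans
    (_ : ereal_sup (counting_ratio L @` [set n | (0 < n)%N]) <= _)%E.
    apply: ereal_inf_lbound; exists [set n | (0 < n)%N] => //.
    exact: nbhs_infty_gt.
  apply: ge_ereal_sup => _ [n /= n0 <-].
  have finA : finite_set (L `&` `[0, n%:R[).
    apply: sub_finite_set (admissible_finite n%:R) => x [Lx /=].
    by rewrite in_itv/= => /andP[].
  have n0R : 0 < n%:R :> R by rewrite ltr0n.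
  rewrite /counting_ratio /counting asboolT// inver gt_eqF// -EFinM lee_fin.
  rewrite ler_pdivrMr// -natrM ler_nat leqNgt; apply/negP => big.
  apply: none; exists n, (finmap.enum_fset (fset_set (L `&` `[0, n%:R[))).
  split.
  - exact: finmap.fset_uniq.
  - by move=> x /=; rewrite in_fset_set// inE.
  - apply: leq_ltn_trans big; rewrite mulnDl leq_add2r; exact: leq_pmulr.
by rewrite sup leye_eq.
Qed.

End Admissible.

(** * Separation by Bohr sets *)

Section Comb.
Variable R : realType.

(** The circle of length [4 * K] is divided into [K] arcs of length [4]; this is
    the union of the lifts to the line of the part [(a, b)] of the arc [i]. The
    length [4] leaves a margin [1] on both sides of [(1, 3)], which absorbs
    approximation errors. *)
Definition comb (K i : nat) (a b : R) : set R :=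
  \bigcup_(m in [set: int])
    `](4 * (m * K%:Z + i%:Z))%:~R + a, (4 * (m * K%:Z + i%:Z))%:~R + b[%classic.

Lemma open_comb K i a b t : open [set x | comb K i a b (t * x)].
Proof.
apply: (@open_comp _ _ ( *%R t) (comb K i a b)).
  by move=> x _; exact: mulrl_continuous.
by apply: bigcup_open => m _; exact: interval_open.
Qed.

Lemma comb_disjoint K (i j : 'I_K) x :
  comb K i 0 4 x -> comb K j 0 4 x -> i = j.
Proof.
move=> [m _ /=]; rewrite in_itv/= => /andP[m1 m2] [p _ /=].
rewrite in_itv/= => /andP[p1 p2].
have : (4 * (m * K%:Z + i%:Z))%:~R < (4 * (p * K%:Z + j%:Z) + 4)%:~R :> R.
  by rewrite [ltRHS]intrD; lra.
have : (4 * (p * K%:Z + j%:Z))%:~R < (4 * (m * K%:Z + i%:Z) + 4)%:~R :> R.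
  by rewrite [ltRHS]intrD; lra.
rewrite !ltr_int => h1 h2; apply: val_inj => /=.
have := ltn_ord i; have := ltn_ord j => jK iK.
have e : m * K%:Z + i%:Z = p * K%:Z + j%:Z by lia.
have := congr1 (fun z => (z %% K%:Z)%Z) e; rewrite !modzMDl !modz_small; lia.
Qed.

Definition band K i t : set R :=
  `]2, 3[%classic `&` [set x | comb K i 0 4 (t * x)].

(** The [K] sets are disjoint subsets of an interval of length [1]. *)
Lemma thin_comb K (t : R) : (0 < K)%N -> exists i : 'I_K,
  (@lebesgue_measure R (band K i t) <= K%:R^-1%:E)%E.
Proof.
move=> K0; pose B (i : 'I_K) := band K i t.
have mB i : measurable (B i).
  apply: measurable_realfun.open_measurable; apply: openI.
    exact: interval_open.
  exact: open_comb.
have mI : @lebesgue_measure R `]2, 3[%classic = 1%E.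
  by rewrite lebesgue_measure_itv/= lte_fin ltr_nat/= -EFinB -natrB.
have Bfin i : @lebesgue_measure R (B i) \is a fin_num.
  rewrite ge0_fin_numE// (@le_lt_trans _ _ 1%E) ?ltry// -mI.
  by apply: le_measure; rewrite ?inE//; [exact: mB|exact: subIsetl].
apply: contrapT => /forallNP none.
have : (\sum_(i < K) @lebesgue_measure R (B i) <= 1)%E.
  rewrite -measure_bigsetU_ord//; last first.
    by move=> i j _ _ [x [[_ /= xi] [_ /= xj]]]; exact: comb_disjoint xi xj.
  rewrite -mI; apply: le_measure; rewrite ?inE//.
    by apply: bigsetU_measurable => i _; exact: mB.
  by elim/big_ind : _ => // [X Y XI YI x [/XI|/YI]//|i _ x []].
under eq_bigr do rewrite -[lebesgue_measure _]fineK//.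
rewrite sumEFin lee_fin leNgt; apply/negP; rewrite negbK.
apply: le_lt_trans (_ : \sum_(i < K) K%:R^-1 < _).
  by rewrite sumr_const card_ord -[_ *+ _]mulr_natl divff// pnatr_eq0 -lt0n.
apply: ltr_sum => [|i _].
  by apply/hasP; exists (Ordinal K0); rewrite // mem_index_enum.
by rewrite -lte_fin fineK// ltNge; apply/negP; exact: none.
Qed.

End Comb.

(** The set [E] lives in a window [(n, n + 2)]. Points of [(0, 1)] reach it
    through independent elements of [[n, n + 1)], which can be rotated at will;
    points of [(2, 3)] reach it only through elements below [n], which are
    hardly rotated at all. *)
Lemma separating_stage (R : realType) (L L' : set R) :
  (forall y, finite_set (L' `&` [set x | x < y])) ->
  alg_independent L -> superlinear L -> L `<=` L' ->
  forall n0 K, (0 < K)%N -> exists E B : set R,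
    [/\ open E, open B, (@lebesgue_measure R B <= K%:R^-1%:E)%E,
      forall x, `]0, 1[%classic x ->
        exists l, [/\ L' l, n0%:R <= l & E (x + l)] &
      forall x l, `]2, 3[%classic x -> L' l -> E (x + l) -> B x].
Proof.
move=> finL' Lind Lsup LL' n0 K K0.
have [n [s [n0n sK sL sind]]] :=
  independent_block finL' Lind Lsup LL' n0 (4 * K).
have [g gE] := (finite_seqP _).1 (finL' n%:R).
have K0R : 0 < K%:R :> R by rewrite ltr0n.
have e0 : 0 < (8 * K%:R)^-1 :> R by rewrite invr_gt0 mulr_gt0.
rewrite gE in sind.
have [t0 [tg ts]] := kronecker_mod (fun j => j%:R / (4 * K%:R)) sind e0.
(* Rescaled so that the circle has length 4 * K and the 4 * K independent
   points are sent close to 0, 1, ..., 4 * K - 1. *)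
pose t := 4 * K%:R * t0.
have err (y a : R) : `|y| < (8 * K%:R)^-1 -> a = 4 * K%:R * y ->
    - (1 / 2) < a < 1 / 2.
  move=> yK ->; rewrite -ltr_norml normrM gtr0_norm ?mulr_gt0//.
  rewrite -ltr_pdivlMl ?mulr_gt0// (lt_le_trans yK)//.
  by rewrite le_eqVlt; apply/orP; left; apply/eqP; field; rewrite gt_eqF.
have {}tg l : L' l -> l < n%:R -> exists p : int,
    - (1 / 2) < t * l - (4 * (p * K%:Z))%:~R < 1 / 2.
  move=> L'l ln; have [|p pP] := tg l.
    by have : [set` g] l by rewrite -gE.
  by exists p; apply: err pP _; rewrite /t !intrM; ring.
have {}ts j : (j < 4 * K)%N -> exists p : int,
    - (1 / 2) < t * s`_j - j%:R - (4 * (p * K%:Z))%:~R < 1 / 2.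
  move=> jK; have [|p pP] := ts j; first by rewrite sK.
  exists p; apply: err pP _; rewrite /t !intrM; field.
  by rewrite gt_eqF.
have [i iK] := thin_comb t K0.
exists (`]n%:R, n.+2%:R[%classic `&` [set x | comb K i 1 3 (t * x)]),
  (band K i t); split=> //.
- by apply: openI; [exact: interval_open|exact: open_comb].
- by apply: openI; [exact: interval_open|exact: open_comb].
- move=> x; rewrite /= in_itv/= => /andP[x0 x1].
  (* Some integer translate t * x + J lies within 1 / 2 of the centre 4 * i + 2
     of the arc, and j is the residue of J modulo 4 * K. *)
  pose z := 4 * i%:R + 5 / 2 - t * x.
  pose J := Num.floor z.
  have := Num.Theory.floor_itv z; rewrite intrD -/J => /andP[J1 J2].
  have K4 : (4 * K%:Z != 0)%R by rewrite mulf_neq0// eqz_nat -lt0n.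
  pose j := `|(J %% (4 * K%:Z))%Z|%N.
  have jE : j%:Z = (J %% (4 * K%:Z))%Z.
    by rewrite /j gez0_abs// modz_ge0.
  have jK : (j < 4 * K)%N.
    rewrite -ltz_nat jE; have := ltz_mod J K4; lia.
  have [p /andP[p1 p2]] := ts j jK.
  have /sL[L's] : [set` s] s`_j by apply: mem_nth; rewrite sK.
  rewrite /= in_itv/= => /andP[s1 s2].
  exists s`_j; split=> //; first by rewrite (le_trans _ s1)// ler_nat.
  split; first by rewrite /= in_itv/=; rewrite -natr1 in s2; rewrite -!natr1;
    apply/andP; split; lra.
  pose q := (J %/ (4 * K%:Z))%Z.
  have JE : J%:~R = 4 * q%:~R * K%:R + j%:R :> R.
    rewrite [in LHS](divz_eq J (4 * K%:Z)) -jE intrD !intrM -/q.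
    by congr (_ + _); rewrite -pmulrn; ring.
  exists (p - q) => //; rewrite /= in_itv/= mulrDr.
  rewrite !(intrM, intrD, rmorphN)/= -!pmulrn in p1 p2 *.
  rewrite /z JE in J1 J2.
  by apply/andP; split; lra.
- move=> x l x23 L'l [] /=; move: (x23); rewrite /= !in_itv/=.
  move=> /andP[x2 x3] /andP[n1 n2] [m _]; rewrite /= in_itv/= => /andP[m1 m2].
  split; first by rewrite /= in_itv/= x2.
  (* Beyond 2, a translate that lies below n + 2 uses an element below n. *)
  have ln : l < n%:R by rewrite -!natr1 in n2; lra.
  have [p /andP[p1 p2]] := tg l L'l ln.
  exists (m - p) => //; rewrite /= in_itv/=; rewrite mulrDr in m1 m2.
  rewrite !(intrM, intrD, rmorphN)/= -!pmulrn in m1 m2 p1 p2 *.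
  by apply/andP; split; lra.
Qed.

Lemma type2_of_superlinear (R : realType) (L L' : set R) :
  admissible L' -> alg_independent L -> superlinear L -> L `<=` L' -> type2 L'.
Proof.
move=> admL' Lind Lsup LL'.
have stage := separating_stage (admissible_finite admL') Lind Lsup LL'.
(* With 2 ^ (j + 2) arcs at stage j, the exceptional sets have total measure at
   most 1 / 2. *)
have /choice[E /choice[B EB]] (j : nat) :=
  stage j (2 ^ j.+2)%N (expn_gt0 2 j.+2).
have mB j : measurable (B j).
  by have [_ oB _ _ _] := EB j; exact: measurable_realfun.open_measurable.
have mUB : measurable (\bigcup_j B j) by exact: bigcup_measurable.
have UB : (@lebesgue_measure R (\bigcup_j B j) <= (1 / 2)%:E)%E.
  apply: le_trans.
    exact: (measure_sigma_subadditive (@lebesgue_measure R) mB mUB).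
  apply: le_trans (epsilon_trick0 xpredT _); last by lra.
  apply: lee_nneseries => [j _ //|j _]; have [_ _ + _ _] := EB j.
  move=> /le_trans; apply; rewrite lee_fin expnS natrM invfM.
  by rewrite mul1r.
apply: (@type2_of_open R L' (\bigcup_j E j) `]0, 1[%classic
    (`]2, 3[%classic `\` \bigcup_j B j)).
- by apply: bigcup_open => j _; have [] := EB j.
- by rewrite lebesgue_measure_itv/= lte_fin ltr01 -EFinB lte_fin subr0.
- rewrite ltNge; apply/negP => C0.
  have : (@lebesgue_measure R `]2%R, 3%R[ <= (1 / 2)%:E)%E.
    apply: le_trans UB; rewrite -[leRHS]add0e.
    apply: le_trans (leeD2r _ C0).
    apply: le_trans (measureU2 _ _ _) => //.
      apply: le_measure; rewrite ?inE//.
        by apply: measurableU => //; exact: measurableD.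
      by move=> x x23; have [|] := EM ((\bigcup_j B j) x); [right|left].
    exact: measurableD.
  by rewrite lebesgue_measure_itv/= lte_fin ifT -?EFinB ?lee_fin; lra.
(* Stage b uses an element of L' that is at least b, so the elements used by
   all the stages are unbounded. *)
- move=> x x01 fin.
  have [s sE] := (finite_seqP _).1 fin.
  pose b := (Num.truncn (\sum_(l <- s) `|l|)).+1.
  have [_ _ _ /(_ x x01)[l [L'l bl El]] _] := EB b.
  have : [set` s] l by rewrite -sE; split=> //=; exists b.
  move=> /= ls; have : \sum_(l <- s) `|l| < b%:R by rewrite truncnS_gt.
  rewrite (big_rem l)//=.
  have : 0 <= \sum_(y <- rem l s) `|y| by exact: sumr_ge0.
  by have := ler_norm l; lra.
- move=> x l [x23 nB] L'l [j _ El]; apply: nB; exists j => //.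
  by have [_ _ _ _] := EB j; apply; eauto.
Qed.

Theorem theorem2p7 (R : realType) (L : set R) :
  admissible L ->
  alg_independent L ->
  limn_esup (counting_ratio L) = +oo%E ->
  forall L' : set R, admissible L' -> L' `<=` L \/ L `<=` L' -> type2 L'.
Proof.
move=> admL Lind Lsup L' admL' [L'L|LL']; last first.
  apply: (type2_of_superlinear admL' Lind _ LL').
  exact: superlinear_of_limsup.
have [[d [d0 infG]]|nogap] :=
  EM (exists d, 0 < d /\ infinite_set (gap_start L' d)).
  exact: type2_of_gaps d0 infG.
apply: (@type2_of_superlinear _ L' L') => //.
  by move=> N a k ainj aL'; apply: Lind => // i; exact: L'L.
apply: superlinear_of_no_gaps => // d d0.
by apply: contrapT => infG; apply: nogap; exists d.
Qed.
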